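(* There is an absolute constant $K>0$ such that the following holds. Let $(\Omega,\pi)$ be a finite probability space, let $n\in\mathbb{N}$, and let $C>0$. Let $f:\Omega^n\to\{-1,1\}$ satisfy $\mathbb{E}_{x\sim\pi^{\otimes n}}[f(x)]=0$ and $\mathbb{I}[f]<C$. Then \[ \mathbb{E}_{x\sim\pi^{\otimes n}}\Big[\max_{S\subseteq[n],\ 0<|S|\le 10C}\big|f^{\subseteq S}(x)\big|\Big] > \delta, \] where $\delta=2^{-KC^2}$.
   Context: $(\Omega^n,\pi^{\otimes n})$ is the $n$-fold product probability space; all expectations are over $x\sim\pi^{\otimes n}$. For $S\subseteq[n]$ with complement $\bar S$, write $x=(x_S,x_{\bar S})$ and define $f^{\subseteq S}(x)=\mathbb{E}_{x_{\bar S}\sim\pi^{\otimes \bar S}}[f(x_S,x_{\bar S})]$, a function of $x_S$ only. The $i$th expectation operator is $E_if(x)=\mathbb{E}_{x_i\sim\pi}[f(x_1,\dots,x_n)]$ (averaging over coordinate $i$ only), the Laplacian is $L_if=f-E_if$, the influence of coordinate $i$ is $\mathrm{Inf}_i[f]=\mathbb{E}[(L_if)^2]$, and the total influence is $\mathbb{I}[f]=\sum_{i=1}^n\mathrm{Inf}_i[f]$. *)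

(* Defs.v *)
From Stdlib Require Import Reals.
From mathcomp Require Import all_boot.

Set Implicit Arguments.
Unset Strict Implicit.
Unset Printing Implicit Defensive.

Local Open Scope R_scope.

Definition Rsum {T : finType} (F : T -> R) : R := \big[Rplus/0]_(x : T) F x.

Definition is_prob {Omega : finType} (pi : Omega -> R) : Prop :=
  (forall a, 0 <= pi a) /\ Rsum pi = 1.

Notation pt Omega n := {ffun 'I_n -> Omega}.

Definition prodw {Omega : finType} (pi : Omega -> R) {n : nat} (x : pt Omega n) : R :=
  \big[Rmult/1]_(i < n) pi (x i).

Definition expect {Omega : finType} (pi : Omega -> R) {n : nat}
  (F : pt Omega n -> R) : R :=
  Rsum (fun x => prodw pi x * F x).

Definition restrictE {Omega : finType} (pi : Omega -> R) {n : nat}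
  (S : {set 'I_n}) (f : pt Omega n -> R) (x : pt Omega n) : R :=
  expect pi (fun y => f [ffun i => if i \in S then x i else y i]).

Definition Ei {Omega : finType} (pi : Omega -> R) {n : nat} (i : 'I_n)
  (f : pt Omega n -> R) (x : pt Omega n) : R :=
  Rsum (fun a => pi a * f [ffun j => if j == i then a else x j]).

Definition Li {Omega : finType} (pi : Omega -> R) {n : nat} (i : 'I_n)
  (f : pt Omega n -> R) (x : pt Omega n) : R := f x - Ei pi i f x.

Definition Inf {Omega : finType} (pi : Omega -> R) {n : nat} (i : 'I_n)
  (f : pt Omega n -> R) : R := expect pi (fun x => (Li pi i f x) ^ 2).

Definition total_inf {Omega : finType} (pi : Omega -> R) {n : nat}
  (f : pt Omega n -> R) : R := \big[Rplus/0]_(i < n) Inf pi i f.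

Definition Rleb (a b : R) : bool := if Rle_dec a b then true else false.

(* max_{S subseteq [n], 0 < |S| <= B} |f^{subseteq S}(x)|  (0 if no such S;
   all terms are >= 0 so 0 is a neutral start for the max). *)
Definition max_restrict {Omega : finType} (pi : Omega -> R) {n : nat}
  (B : R) (f : pt Omega n -> R) (x : pt Omega n) : R :=
  \big[Rmax/0]_(S : {set 'I_n} | (0 < #|S|)%N && Rleb (INR #|S|) B)
     Rabs (restrictE pi S f x).

(* Main.v *)
Require Import Defs.
From Stdlib Require Import Reals Lra Psatz.
From mathcomp Require Import all_boot all_order all_algebra.
From mathcomp Require Import boolp Rstruct zify ring lra.

(* Write E_i for averaging over x_i, L_i = 1 - E_i, and f = \sum_S f^{=S} for the
   Efron-Stein decomposition.  Two square function inequalities in L^4,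
     E (\sum_S 4^-|S| f^{=S}(x)^2)^2 <= E f^4,
     E (\sum_S 3^-|S| (G_S)^{=S}(x))^4 <= E (\sum_S G_S(x)^2)^2,
   hold for every product space: both tensorize, so they reduce to one-variable
   inequalities.  They replace Bourgain's symmetrization by random signs together
   with the hypercontractivity of the noise operator.
   Put V_i(x) = \sum_(S \ni i) 9^-|S| f^{=S}(x)^2 and call i notable at x when
   V_i(x) >= sigma^3.  The dual inequality, tested against L_i f (for which
   E |L_i f| = E (L_i f)^2 as f is +-1 valued), gives
   E [V_i 1_{i not notable}] <= sigma Inf_i, so the f^{=S} with |S| <= k that meet
   non-notable coordinates carry little mass.  The first inequality shows that the
   points with too many notable coordinates carry little mass as well.  At the
   remaining points only 2^{O(k^2)} sets S matter, and each |f^{=S}(x)| is at most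
   2^|S| times the maximum of the |f^{\subseteq T}(x)|.  Since at least 9/10 of the
   mass of f is on 0 < |S| <= k = floor(10C), that maximum has mean 2^{-O(C^2)}. *)

Set Implicit Arguments.
Unset Strict Implicit.
Unset Printing Implicit Defensive.
Import Order.TTheory GRing.Theory Num.Theory.

(** * Finite weighted sums: linearity, Cauchy-Schwarz and variance *)

Section WeightedSums.
Local Open Scope ring_scope.
Variables (R : realFieldType) (T : finType).
Implicit Types (w u v : T -> R).

Definition wsum w u : R := \sum_x w x * u x.

Lemma eq_wsum w u v : u =1 v -> wsum w u = wsum w v.
Proof. by move=> e; apply: eq_bigr => x _; rewrite e. Qed.

Lemma wsumD w u v : wsum w (fun x => u x + v x) = wsum w u + wsum w v.
Proof. by rewrite /wsum -big_split; apply: eq_bigr => x _; rewrite mulrDr. Qed.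

Lemma wsumZ w c u : wsum w (fun x => c * u x) = c * wsum w u.
Proof. by rewrite /wsum mulr_sumr; apply: eq_bigr => x _; rewrite mulrCA. Qed.

Lemma wsumB w u v : wsum w (fun x => u x - v x) = wsum w u - wsum w v.
Proof. by rewrite -[- wsum w v]mulN1r -wsumZ -wsumD; apply: eq_wsum => x; rewrite mulN1r. Qed.

Lemma wsum_sum (J : finType) w (P : pred J) (F : J -> T -> R) :
  wsum w (fun x => \sum_(j | P j) F j x) = \sum_(j | P j) wsum w (F j).
Proof.
by rewrite /wsum exchange_big; apply: eq_bigr => x _; rewrite mulr_sumr.
Qed.

Lemma wsum_cst w c : \sum_x w x = 1 -> wsum w (fun=> c) = c.
Proof. by move=> w1; rewrite /wsum -mulr_suml w1 mul1r. Qed.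

Variable w : T -> R.
Hypothesis w_ge0 : forall x, 0 <= w x.

Lemma wsum_ge0 u : (forall x, 0 <= u x) -> 0 <= wsum w u.
Proof. by move=> u0; apply: sumr_ge0 => x _; rewrite mulr_ge0. Qed.

Lemma wsum_le u v : (forall x, u x <= v x) -> wsum w u <= wsum w v.
Proof. by move=> uv; apply: ler_sum => x _; rewrite ler_wpM2l. Qed.

(** Lagrange's identity: the double sum of [(u x * v y - u y * v x) ^+ 2] equals 2 (A B - C^2). *)
Lemma wsum_CauchySchwarz u v :
  wsum w (fun x => u x * v x) ^+ 2
    <= wsum w (fun x => u x ^+ 2) * wsum w (fun x => v x ^+ 2).
Proof.
set C := wsum w _; set A := wsum w _; set B := wsum w _.
have inner x : wsum w (fun y => (u x * v y - u y * v x) ^+ 2)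
    = B * u x ^+ 2 - 2 * C * (u x * v x) + A * v x ^+ 2.
  under eq_wsum => y do
    have -> : (u x * v y - u y * v x) ^+ 2 = u x ^+ 2 * v y ^+ 2
      - 2 * (u x * v x) * (u y * v y) + v x ^+ 2 * u y ^+ 2 by ring.
  by rewrite wsumD wsumB !wsumZ -/A -/B -/C; ring.
have : 0 <= wsum w (fun x => wsum w (fun y => (u x * v y - u y * v x) ^+ 2)).
  by apply: wsum_ge0 => x; apply: wsum_ge0 => y; apply: sqr_ge0.
under eq_wsum do rewrite inner.
rewrite wsumD wsumB !wsumZ -/A -/B -/C; nra.
Qed.

Hypothesis w_sum : \sum_x w x = 1.

Lemma wsum_sqr_le u : wsum w u ^+ 2 <= wsum w (fun x => u x ^+ 2).
Proof.
have := wsum_CauchySchwarz u (fun=> 1).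
under eq_wsum do rewrite mulr1.
by rewrite [X in _ * X]wsum_cst // expr1n mulr1.
Qed.

Lemma wsum_centered u : wsum w (fun x => u x - wsum w u) = 0.
Proof. by rewrite wsumB wsum_cst // subrr. Qed.

Lemma wsum_variance u :
  wsum w (fun x => (u x - wsum w u) ^+ 2) = wsum w (fun x => u x ^+ 2) - wsum w u ^+ 2.
Proof.
under eq_wsum => x do
  have -> : (u x - wsum w u) ^+ 2 = u x ^+ 2 - 2 * wsum w u * u x + wsum w u ^+ 2 by ring.
by rewrite wsumD wsumB wsumZ wsum_cst //; ring.
Qed.

End WeightedSums.

Lemma wsum_exchange (R : realFieldType) (T U : finType) (w : T -> R) (w' : U -> R)
    (F : T -> U -> R) :
  (wsum w (fun x => wsum w' (F x)) = wsum w' (fun y => wsum w (F ^~ y))).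
Proof.
rewrite /wsum; under eq_bigr do rewrite mulr_sumr.
rewrite exchange_big; apply: eq_bigr => y _; rewrite mulr_sumr.
by apply: eq_bigr => x _; rewrite mulrCA.
Qed.

(** * Fourth-moment inequalities in one variable *)

Section OneVariable.
Local Open Scope ring_scope.
Variables (R : realFieldType) (T J : finType) (w : T -> R) (c : J -> R).
Hypothesis w_ge0 : forall a, 0 <= w a.
Hypothesis w_sum : \sum_a w a = 1.
Hypothesis c_ge0 : forall j, 0 <= c j.

Lemma square_function_step (X : J -> T -> R) :
  wsum w (fun a => wsum c (fun j =>
     wsum w (X j) ^+ 2 + 4^-1 * (X j a - wsum w (X j)) ^+ 2) ^+ 2)
  <= wsum w (fun a => wsum c (fun j => X j a ^+ 2) ^+ 2).
Proof.
pose m j := wsum w (X j).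
pose A := wsum c (fun j => m j ^+ 2).
pose s a := wsum c (fun j => (X j a - m j) ^+ 2).
pose t a := wsum c (fun j => m j * (X j a - m j)).
(* |X|^2 = A + 2 t + s where t has mean zero and t^2 <= A s. *)
have tE : wsum w t = 0.
  rewrite /t wsum_exchange [LHS]big1 // => j _.
  by rewrite wsumZ wsum_centered // !mulr0.
(* Since [t] has mean zero, subtracting [4 * A * t a] is free; it removes the cross term and leaves
   a pointwise inequality. *)
rewrite -[leRHS]subr0 -[X in _ - X](mulr0 (4 * A)) -tE -wsumZ -wsumB.
apply: wsum_le => // a.
have -> : wsum c (fun j => X j a ^+ 2) = A + 2 * t a + s a.
  rewrite /A /t /s -wsumZ -!wsumD; apply: eq_wsum => j; ring.
rewrite wsumD wsumZ -/A -/(s a).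
have A0 : 0 <= A by apply: wsum_ge0 => // j; apply: sqr_ge0.
have s0 : 0 <= s a by apply: wsum_ge0 => // j; apply: sqr_ge0.
have ts : t a ^+ 2 <= A * s a by apply: wsum_CauchySchwarz.
move: (t a) (s a) A A0 s0 ts => t1 s1 A1 A0 s0 ts.
have := sqr_ge0 (5 * t1 + 2 * s1); have := sqr_ge0 t1; have := sqr_ge0 s1; lra.
Qed.

(** [P] and [Q] stand for the members of the family at sets without and with the new coordinate:
    projecting keeps the mean of [P j] and the deviation of [Q j]. *)
Lemma dual_square_function_step (P Q : J -> T -> R) :
  wsum w (fun a => wsum c (fun j =>
     (wsum w (P j) + 3^-1 * (Q j a - wsum w (Q j))) ^+ 2) ^+ 2)
  <= wsum w (fun a => wsum c (fun j => P j a ^+ 2 + Q j a ^+ 2) ^+ 2).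
Proof.
pose A := wsum c (fun j => wsum w (P j) ^+ 2).
pose B := wsum c (fun j => wsum w (Q j) ^+ 2).
pose s a := wsum c (fun j => (Q j a - wsum w (Q j)) ^+ 2).
pose t a := wsum c (fun j => wsum w (P j) * (Q j a - wsum w (Q j))).
pose p a := wsum c (fun j => P j a ^+ 2).
pose q a := wsum c (fun j => Q j a ^+ 2).
have A0 : 0 <= A by apply: wsum_ge0 => // j; apply: sqr_ge0.
have B0 : 0 <= B by apply: wsum_ge0 => // j; apply: sqr_ge0.
have s0 a : 0 <= s a by apply: wsum_ge0 => // j; apply: sqr_ge0.
have p0 a : 0 <= p a by apply: wsum_ge0 => // j; apply: sqr_ge0.
have q0 a : 0 <= q a by apply: wsum_ge0 => // j; apply: sqr_ge0.
have tE : wsum w t = 0.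
  rewrite /t wsum_exchange [LHS]big1 // => j _.
  by rewrite wsumZ wsum_centered // !mulr0.
have sE : wsum w s = wsum w q - B.
  rewrite wsum_exchange [wsum w q]wsum_exchange -wsumB.
  by apply: eq_wsum => j; rewrite wsum_variance.
have AE : A <= wsum w p.
  by rewrite [leRHS]wsum_exchange; apply: wsum_le => // j; apply: wsum_sqr_le.
have BE : B <= wsum w q.
  by rewrite [leRHS]wsum_exchange; apply: wsum_le => // j; apply: wsum_sqr_le.
(* From s <= 2 q + 2 B follows s^2 <= 8 q^2 + 8 B^2, and B is at most the mean of [q]; hence 16. *)
have ssE : wsum w (fun a => s a ^+ 2) <= 16 * wsum w (fun a => q a ^+ 2).
  have B2 : B ^+ 2 <= wsum w (fun a => q a ^+ 2).
    by apply: le_trans (wsum_sqr_le w_ge0 w_sum q); rewrite ler_pXn2r ?nnegrE //; lra.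
  apply: (@le_trans _ _ (wsum w (fun a => 8 * q a ^+ 2 + 8 * B ^+ 2))); last first.
    by rewrite wsumD wsumZ wsum_cst //; lra.
  apply: wsum_le => // a.
  have sq : s a <= 2 * q a + 2 * B.
    rewrite /s /q /B -!wsumZ -wsumD; apply: wsum_le => // j.
    by have := sqr_ge0 (Q j a + wsum w (Q j)); nra.
  have := s0 a; have := q0 a; have := sqr_ge0 (q a - B); nra.
(* As p q >= 0, (p + q)^2 is at least (p + q/2)^2 + (3/4) q^2; Jensen applies to the first
   square. *)
have pqE : wsum w p ^+ 2 + wsum w p * wsum w q + 3 / 4 * wsum w (fun a => q a ^+ 2)
    <= wsum w (fun a => (p a + q a) ^+ 2).
  apply: (@le_trans _ _ (wsum w (fun a => (p a + 2^-1 * q a) ^+ 2 + 3 / 4 * q a ^+ 2))).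
    rewrite wsumD wsumZ lerD2r.
    apply: le_trans (wsum_sqr_le w_ge0 w_sum _); rewrite wsumD wsumZ.
    by have := sqr_ge0 (wsum w q); nra.
  by apply: wsum_le => // a; have := p0 a; have := q0 a; nra.
rewrite [leRHS](_ : _ = wsum w (fun a => (p a + q a) ^+ 2)); last first.
  by apply: eq_wsum => a; rewrite wsumD.
apply: le_trans pqE.
(* The product t s is bounded through (3 t - s)^2 >= 0 and t^2 through A s. The remaining term in
   [t a] has mean zero, and 16/27 <= 3/4 settles the term in [s a ^+ 2]. *)
apply: (@le_trans _ _ (wsum w (fun a =>
    A ^+ 2 + 8 / 9 * A * s a + 27^-1 * s a ^+ 2 + 4 / 3 * A * t a))).
  apply: wsum_le => // a.
  have -> : wsum c (fun j => (wsum w (P j) + 3^-1 * (Q j a - wsum w (Q j))) ^+ 2)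
      = A + 2 / 3 * t a + 9^-1 * s a.
    by rewrite /A /t /s -!wsumZ -!wsumD; apply: eq_wsum => j; field.
  have ts : t a ^+ 2 <= A * s a by apply: wsum_CauchySchwarz.
  have := sqr_ge0 (3 * t a - s a); have := s0 a; nra.
rewrite !wsumD !wsumZ wsum_cst // tE sE mulr0 addr0.
have q0' : 0 <= wsum w q by apply: wsum_ge0.
have q2 : 0 <= wsum w (fun a => q a ^+ 2) by apply: wsum_ge0 => // a; apply: sqr_ge0.
have h1 : A ^+ 2 <= wsum w p ^+ 2 by rewrite ler_pXn2r ?nnegrE //; lra.
have h2 : A * (wsum w q - B) <= wsum w p * wsum w q by apply: ler_pM => //; lra.
have h3 : 0 <= A * (wsum w q - B) by apply: mulr_ge0 => //; lra.
have -> : 8 / 9 * A * (wsum w q - B) = 8 / 9 * (A * (wsum w q - B)) by rewrite mulrA.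
lra.
Qed.

End OneVariable.

(** * Averaging operators and Efron-Stein parts on a product space *)

Section EfronStein.
Local Open Scope ring_scope.
Variables (R : realFieldType) (I Omega : finType) (pi : Omega -> R).
Hypothesis pi_ge0 : forall a, 0 <= pi a.
Hypothesis pi_sum : \sum_a pi a = 1.

Notation pt := {ffun I -> Omega}.
Implicit Types (f g h u v : pt -> R) (x y : pt) (i j : I) (S T U A : {set I}).
Implicit Types (s : seq I).

Definition weight x : R := \prod_i pi (x i).
Local Notation mean := (wsum weight).
Definition upd x i a : pt := [ffun j => if j == i then a else x j].
Definition avg i f x : R := \sum_a pi a * f (upd x i a).
Definition laplacian i f x : R := f x - avg i f x.
Local Notation lap := laplacian.
Definition cond_mean S f x : R := mean (fun y => f [ffun i => if i \in S then x i else y i]).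

Lemma weight_ge0 x : 0 <= weight x.
Proof. exact: prodr_ge0. Qed.

Lemma weight_sum : \sum_x weight x = 1.
Proof.
rewrite /weight -(bigA_distr_bigA (fun _ a => pi a)) /=.
by rewrite big1 // => i _; rewrite pi_sum.
Qed.

Hint Resolve weight_ge0 weight_sum : core.

Lemma upd_upd x i a b : upd (upd x i a) i b = upd x i b.
Proof. by apply/ffunP => j; rewrite !ffunE; case: eqP. Qed.

Lemma updC x i j a b : i != j -> upd (upd x i a) j b = upd (upd x j b) i a.
Proof.
move=> ij; apply/ffunP => k; rewrite !ffunE.
by case: (eqVneq k j) => // ->; rewrite eq_sym (negbTE ij).
Qed.

Lemma upd_id x i : upd x i (x i) = x.
Proof. by apply/ffunP => j; rewrite ffunE; case: eqP => // ->. Qed.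

Lemma weight_upd x i a : weight (upd x i a) * pi (x i) = weight x * pi a.
Proof.
rewrite /weight (bigD1 i) //= [in RHS](bigD1 i) //= ffunE eqxx.
rewrite mulrAC [RHS]mulrAC [pi a * _]mulrC; congr (_ * _).
by apply: eq_bigr => j ji; rewrite ffunE (negbTE ji).
Qed.

(* (x, a) |-> (upd x i a, x i) is a measure-preserving involution of the product. *)
Lemma mean_avg i f : mean (avg i f) = mean f.
Proof.
rewrite /wsum; under eq_bigr do rewrite mulr_sumr.
rewrite pair_big /= (reindex (fun p : pt * Omega => (upd p.1 i p.2, p.1 i))) /=; last first.
  exists (fun p => (upd p.1 i p.2, p.1 i)) => -[x a] _ /=;
    by rewrite upd_upd upd_id ffunE eqxx.
under eq_bigr do rewrite upd_upd upd_id mulrA weight_upd -mulrA.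
rewrite -(pair_big xpredT xpredT (fun x a => weight x * (pi a * f x))) /=.
apply: eq_bigr => x _; rewrite -mulr_sumr -mulr_suml pi_sum mul1r //.
Qed.

Lemma avg_upd i f x a : avg i f (upd x i a) = avg i f x.
Proof. by apply: eq_bigr => b _; rewrite upd_upd. Qed.

Lemma avgE i f x : avg i f x = wsum pi (fun a => f (upd x i a)).
Proof. by []. Qed.

Lemma avg_lin i c u v : avg i (fun x => u x + c * v x) = (fun x => avg i u x + c * avg i v x).
Proof. by apply: funext => x; rewrite avgE wsumD wsumZ. Qed.

Lemma avg_absorb i u v :
  avg i (fun x => avg i u x * v x) = (fun x => avg i u x * avg i v x).
Proof.
by apply: funext => x; rewrite avgE; under eq_wsum do rewrite avg_upd; rewrite wsumZ.
Qed.

Lemma mean_avgl i u v :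
  mean (fun x => avg i u x * v x) = mean (fun x => avg i u x * avg i v x).
Proof. by rewrite -(mean_avg i) avg_absorb. Qed.

Lemma mean_avg_adj i u v :
  mean (fun x => avg i u x * v x) = mean (fun x => u x * avg i v x).
Proof.
rewrite mean_avgl; under eq_wsum do rewrite mulrC.
by rewrite -mean_avgl; apply: eq_wsum => x; rewrite mulrC.
Qed.

Lemma avg_avg i f : avg i (avg i f) = avg i f.
Proof.
by apply: funext => x; rewrite avgE; under eq_wsum do rewrite avg_upd; rewrite wsum_cst.
Qed.

Lemma avgC i j f : avg i (avg j f) = avg j (avg i f).
Proof.
have [->//|ij] := eqVneq i j; apply: funext => x.
rewrite avgE wsum_exchange; apply: eq_wsum => b; apply: eq_wsum => a.
by rewrite updC.
Qed.

Lemma avgB i u v : avg i (fun x => u x - v x) = (fun x => avg i u x - avg i v x).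
Proof. by apply: funext => x; rewrite avgE wsumB. Qed.

Definition es_op (b : bool) i f := if b then lap i f else avg i f.
(** For [s] an enumeration of [I] this is f^{=S}. The list lets inductions process one coordinate at
    a time. *)
Definition es_part s S f := foldr (fun i => es_op (i \in S) i) f s.

Lemma es_op_lin b i c u v :
  es_op b i (fun x => u x + c * v x) = (fun x => es_op b i u x + c * es_op b i v x).
Proof.
case: b; last exact: avg_lin.
by apply: funext => x; rewrite /= /lap avg_lin; ring.
Qed.

Lemma es_opC b i b' j f : es_op b i (es_op b' j f) = es_op b' j (es_op b i f).
Proof.
case: b; case: b' => /=; rewrite /lap ?avgB ?(avgC i j) //.
by apply: funext => x; ring.
Qed.

Lemma es_part_lin s S c u v :
  es_part s S (fun x => u x + c * v x) = (fun x => es_part s S u x + c * es_part s S v x).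
Proof. by elim: s => //= i s ->; rewrite es_op_lin. Qed.

Lemma es_part_opC b i s S f : es_op b i (es_part s S f) = es_part s S (es_op b i f).
Proof. by elim: s => //= j s IH; rewrite es_opC IH. Qed.

Lemma es_op_adj b i u v :
  mean (fun x => es_op b i u x * v x) = mean (fun x => u x * es_op b i v x).
Proof.
case: b => /=; last exact: mean_avg_adj.
under eq_wsum do rewrite mulrBl; under [RHS]eq_wsum do rewrite mulrBr.
by rewrite !wsumB mean_avg_adj.
Qed.

Lemma es_part_adj s S u v :
  mean (fun x => es_part s S u x * v x) = mean (fun x => u x * es_part s S v x).
Proof. by elim: s v => //= i s IH v; rewrite es_op_adj IH -es_part_opC. Qed.

Lemma mean_lap_sqr i f :
  mean (fun x => lap i f x ^+ 2) = mean (fun x => f x ^+ 2) - mean (fun x => avg i f x ^+ 2).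
Proof.
under eq_wsum => x do
  have -> : lap i f x ^+ 2 = f x ^+ 2 - 2 * (avg i f x * f x) + avg i f x ^+ 2
    by rewrite /lap; ring.
rewrite wsumD wsumB wsumZ mean_avgl.
by under [wsum _ (fun x => avg i f x * _)]eq_wsum do rewrite -expr2; ring.
Qed.

Lemma lap_es_part s S i f : i \in s ->
  lap i (es_part s S f) = if i \in S then es_part s S f else (fun=> 0).
Proof.
elim: s => //= j s IH; rewrite inE; case: eqVneq => [->|_] /=.
  move=> _; case: (j \in S) => /=; apply: funext => x;
    rewrite /lap ?avgB !avg_avg subrr ?subr0 //.
move=> /IH{}IH; rewrite (es_opC true i _ j _ : lap i _ = _) /= IH; case: ifP => // _.
apply: funext => x; case: (j \in S) => /=; rewrite ?/lap avgE ?sub0r.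
  by rewrite /wsum big1 ?oppr0 // => a _; rewrite mulr0.
by rewrite /wsum big1 // => a _; rewrite mulr0.
Qed.

(** Vanishing off the subsets of [s], it turns a sum over those subsets into a [wsum] over the fixed
    type [{set I}], to which the general lemmas apply. *)
Definition setw (c : R) s S : R := (S \subset [set i in s])%:R * c ^+ #|S|.

Lemma setw_ge0 c s S : 0 <= c -> 0 <= setw c s S.
Proof. by move=> c0; rewrite mulr_ge0 ?ler0n ?exprn_ge0. Qed.

Lemma wsum_setw_nil c (F : {set I} -> R) : wsum (setw c [::]) F = F set0.
Proof.
rewrite /wsum (bigD1 set0) //= big1 ?addr0 => [|S S0].
  by rewrite /setw sub0set cards0 expr0 !mul1r.
have -> : setw c [::] S = 0; last by rewrite mul0r.
rewrite /setw (_ : _ \subset _ = false) ?mul0r //.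
apply: contraNF S0 => /subsetP h; apply/eqP/setP => i; rewrite inE.
by apply/negbTE/negP => /h; rewrite inE.
Qed.

Lemma setw_notin c i s S : i \notin s -> i \in S -> setw c s S = 0.
Proof.
move=> is_ iS; rewrite /setw (_ : _ \subset _ = false) ?mul0r //.
by apply: contraNF is_ => /subsetP /(_ i iS); rewrite inE.
Qed.

(** Subsets of [i :: s] come in pairs S, S + i with S a subset of [s]; this drives the inductions
    for the square functions and for Parseval. *)
Lemma wsum_setw_cons c i s (F : {set I} -> R) : i \notin s ->
  wsum (setw c (i :: s)) F = wsum (setw c s) (fun S => F S + c * F (i |: S)).
Proof.
move=> is_; rewrite wsumD wsumZ /wsum.
have sub S : i \notin S -> (S \subset [set j in i :: s]) = (S \subset [set j in s]).
  move=> iS; apply/subsetP/subsetP => h j jS; move: (h j jS); rewrite !inE.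
    by case: eqP => // ji; rewrite -ji jS in iS.
  by move=> ->; rewrite orbT.
have nsub S : i \in S -> setw c s S = 0 by apply: setw_notin.
rewrite (bigID (fun S => i \in S)) /= addrC; congr (_ + _).
  rewrite [RHS](bigID (fun S => i \in S)) /= [X in X + _]big1 ?add0r.
    by apply: eq_bigr => S iS; rewrite /setw sub.
  by move=> S /nsub ->; rewrite mul0r.
rewrite mulr_sumr [RHS](bigID (fun S => i \in S)) /= [X in X + _]big1 ?add0r; last first.
  by move=> S /nsub ->; rewrite mul0r mulr0.
rewrite (reindex_onto (fun S => i |: S) (fun S => S :\ i)) /=; last first.
  by move=> S iS; rewrite setD1K.
apply: eq_big => [S|S /andP[_ /eqP e]].
  rewrite setU11 /=; apply/eqP/idP => [<-|iS]; first by rewrite !inE eqxx.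
  by rewrite setU1K.
have iS : i \notin S by rewrite -e !inE eqxx.
rewrite /setw cardsU1 iS exprS.
rewrite (_ : (i |: S \subset _) = (S \subset [set j in s])); first by ring.
rewrite -sub // subUset sub1set !inE eqxx //.
Qed.

Lemma es_part_setU1 i s S f : i \notin s -> es_part s (i |: S) f = es_part s S f.
Proof.
elim: s => //= j s IH; rewrite inE negb_or => /andP[ij /IH ->].
by rewrite in_setU1 eq_sym (negbTE ij).
Qed.

Lemma eq_wsum_setw c i s (F G : {set I} -> R) : i \notin s ->
  (forall S, i \notin S -> F S = G S) -> wsum (setw c s) F = wsum (setw c s) G.
Proof.
move=> is_ FG; apply: eq_bigr => S _; case: (boolP (i \in S)) => [iS|/FG-> //].
by rewrite (setw_notin c is_ iS) !mul0r.
Qed.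

(** Freezing all coordinates but [i] turns the parts along [s] into functions of [x i];
    [square_function_step], with index [j] running over sets, then adds the coordinate [i]. *)
Lemma square_function s f : uniq s ->
  mean (fun x => wsum (setw 4^-1 s) (fun S => es_part s S f x ^+ 2) ^+ 2)
  <= mean (fun x => f x ^+ 4).
Proof.
elim: s => [_|i s IH /= /andP[is_ us]].
  apply: wsum_le => // x; rewrite wsum_setw_nil /=; lra.
apply: le_trans (IH us); rewrite -(mean_avg i) -[leRHS](mean_avg i).
apply: wsum_le => // x; rewrite !avgE.
under eq_wsum => a.
  rewrite wsum_setw_cons //=.
  under (eq_wsum_setw _ is_) => S iS.
    rewrite setU11 (negbTE iS) es_part_setU1 // /es_op /lap avg_upd.
    over.
  over.
apply: (@square_function_step _ _ _ pi (setw 4^-1 s) pi_ge0 pi_sum _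
  (fun S a => es_part s S f (upd x i a))).
by move=> S; apply: setw_ge0; rewrite invr_ge0.
Qed.

(** The coordinate [i] is absorbed into the family: [H S] merges [G S] and [G (i |: S)], the
    induction hypothesis is applied to [H], and [dual_square_function_step] bounds the squares of
    [H] by those of [G]. *)
Lemma dual_square_function s (G : {set I} -> pt -> R) : uniq s ->
  mean (fun x => wsum (setw 3^-1 s) (fun S => es_part s S (G S) x) ^+ 4)
  <= mean (fun x => wsum (setw 1 s) (fun S => G S x ^+ 2) ^+ 2).
Proof.
elim: s G => [G _|i s IH G /= /andP[is_ us]].
  apply: wsum_le => // x; rewrite !wsum_setw_nil /=; lra.
pose H S x := avg i (G S) x + 3^-1 * lap i (G (i |: S)) x.
have -> : (fun x => wsum (setw 3^-1 (i :: s))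
      (fun S => es_op (i \in S) i (es_part s S (G S)) x) ^+ 4) =
    (fun x => wsum (setw 3^-1 s) (fun S => es_part s S (H S) x) ^+ 4).
  apply: funext => x; congr (_ ^+ 4); rewrite wsum_setw_cons //.
  apply: (eq_wsum_setw _ is_) => S iS.
  rewrite setU11 (negbTE iS) es_part_setU1 // !es_part_opC /=.
  by rewrite /H es_part_lin.
apply: le_trans (IH H us) _; rewrite -(mean_avg i) -[leRHS](mean_avg i).
apply: wsum_le => // x; rewrite !avgE.
under eq_wsum do under eq_wsum do rewrite /H /lap !avg_upd.
under [leRHS]eq_wsum do (rewrite wsum_setw_cons //; under eq_wsum do rewrite mul1r).
apply: (@dual_square_function_step _ _ _ pi (setw 1 s) pi_ge0 pi_sum _
  (fun S a => G S (upd x i a)) (fun S a => G (i |: S) (upd x i a))).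
by move=> S; apply: setw_ge0.
Qed.

Lemma parseval_seq s f : uniq s ->
  wsum (setw 1 s) (fun S => mean (fun x => es_part s S f x ^+ 2)) = mean (fun x => f x ^+ 2).
Proof.
elim: s => [_|i s IH /= /andP[is_ us]]; first by rewrite wsum_setw_nil.
rewrite -(IH us) wsum_setw_cons //; apply: (eq_wsum_setw _ is_) => S iS.
by rewrite setU11 (negbTE iS) es_part_setU1 //= mean_lap_sqr mul1r addrC subrK.
Qed.

(** * Conditional means and their Efron-Stein parts *)

Lemma cond_mean_setT f : cond_mean setT f = f.
Proof.
apply: funext => x; rewrite /cond_mean; under eq_wsum => y.
  have -> : [ffun i => if i \in setT then x i else y i] = x by
    apply/ffunP => i; rewrite ffunE inE.
  over.
by rewrite wsum_cst.
Qed.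

Lemma cond_mean_set0 f x : cond_mean set0 f x = mean f.
Proof. by apply: eq_wsum => y; congr f; apply/ffunP => i; rewrite ffunE inE. Qed.

Lemma avg_cond_mean i S f : avg i (cond_mean S f) = cond_mean (S :\ i) f.
Proof.
apply: funext => x; rewrite avgE /cond_mean; case: (boolP (i \in S)) => iS; last first.
  rewrite -[RHS](wsum_cst _ pi_sum); apply: eq_wsum => a; apply: eq_wsum => y; congr f.
  apply/ffunP => j; rewrite !ffunE !inE.
  by case: eqVneq => // ->; rewrite (negbTE iS).
rewrite -[RHS](mean_avg i) wsum_exchange; apply: eq_wsum => y; apply: eq_wsum => a; congr f.
apply/ffunP => j; rewrite !ffunE !inE.
by case: eqVneq => //= ->; rewrite iS.
Qed.

(** Each E_i deletes [i] from the conditioning set and each L_i yields two terms, whence the power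
    of 2. The premises on [T] describe the sets that can occur: only elements of [s] are removed
    from [U], and those outside [S] always are. *)
Lemma es_part_cond_mean_le s S U f x (m : R) : uniq s ->
  (forall T, U :\: T \subset [set i in s] -> T :&: [set i in s] \subset S ->
     T \subset U -> `|cond_mean T f x| <= m) ->
  `|es_part s S (cond_mean U f) x| <= 2 ^+ #|S :&: [set i in s]| * m.
Proof.
elim: s U => [U _ /(_ U) h|i s IH U /= /andP[is_ us] h].
  rewrite set_nil setI0 cards0 expr0 mul1r; apply: h => //.
    by rewrite setDv sub0set.
  by rewrite set_nil setI0 sub0set.
have hd : `|es_part s S (avg i (cond_mean U f)) x| <= 2 ^+ #|S :&: [set i in s]| * m.
  rewrite avg_cond_mean; apply: IH => // T h1 h2 h3; apply: h.
  - apply/subsetP => j; rewrite !inE => /andP[jT jU].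
    by case: eqVneq => //= ji; move/subsetP: h1 => /(_ j); rewrite !inE ji jU jT => /(_ isT).
  - apply/subsetP => j; rewrite !inE => /andP[jT].
    case: eqVneq => [ji|_ /= js]; last first.
      by move/subsetP: h2 => /(_ j); rewrite !inE jT js => /(_ isT).
    by move/subsetP: h3 => /(_ j jT); rewrite !inE ji eqxx.
  - by apply: subset_trans h3 (subsetDl _ _).
have cS : S :&: [set j in i :: s] =
    if i \in S then i |: (S :&: [set j in s]) else S :&: [set j in s].
  case: ifP => iS; apply/setP => j; rewrite !inE; case: eqVneq => //= ->; first by rewrite iS.
  by rewrite iS.
rewrite es_part_opC cS /es_op; case: ifP => iS //.
have -> : lap i (cond_mean U f) =
    (fun x => cond_mean U f x + (-1) * avg i (cond_mean U f) x).
  by apply: funext => y; rewrite mulN1r.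
rewrite es_part_lin cardsU1 !inE (negbTE is_) andbF exprS mulN1r.
have hu : `|es_part s S (cond_mean U f) x| <= 2 ^+ #|S :&: [set i in s]| * m.
  apply: IH => // T h1 h2 h3; apply: h => //.
    apply: subset_trans h1 _; apply/subsetP => j; rewrite !inE => ->; exact: orbT.
  apply/subsetP => j; rewrite !inE => /andP[jT]; case: eqVneq => [-> //|_ /= js].
  by move/subsetP: h2 => /(_ j); rewrite !inE jT js => /(_ isT).
by apply: le_trans (ler_normB _ _) _; rewrite -mulrA mulrDl mul1r; apply: lerD.
Qed.

End EfronStein.

(** A set of size at most k + 1 arises from one of size at most k by adding an element of [J] or,
    for [None], nothing: a factor |J| + 1 per step. *)
Lemma card_small_subsets (T : finType) (J : {set T}) k :
  (#|[set S : {set T} | (S \subset J) && (#|S| <= k)]| <= #|J|.+1 ^ k)%N.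
Proof.
elim: k => [|k IH].
  rewrite expn0 (_ : [set S | _] = [set set0]) ?cards1 //.
  by apply/setP => S; rewrite !inE leqn0 cards_eq0; case: eqP => [->|]; rewrite ?sub0set ?andbF.
pose O := None |: [set Some i | i in J].
pose add (p : option T * {set T}) := if p.1 is Some i then i |: p.2 else p.2.
have cO : #|O| = #|J|.+1.
  rewrite cardsU1 card_imset; last by move=> ? ? [].
  by rewrite (_ : None \notin _) //; apply/imsetP => -[].
rewrite expnS; rewrite -cO in IH *.
apply: leq_trans _ (leq_mul (leqnn _) IH); rewrite -cardsX.
apply: leq_trans _ (leq_imset_card add _); apply/subset_leq_card/subsetP => S.
rewrite inE => /andP[SJ]; rewrite leq_eqVlt ltnS => /orP[/eqP cS|cS]; last first.
  by apply/imsetP; exists (None, S); rewrite // !inE SJ cS.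
have /card_gt0P[i iS] : (0 < #|S|)%N by rewrite cS.
apply/imsetP; exists (Some i, S :\ i); last by rewrite /add /= setD1K.
rewrite !inE /= (subset_trans (subsetDl _ _) SJ) -ltnS (cardsD1 i) iS in cS *.
rewrite -ltnS -cS add1n leqnn andbT andbT.
by apply/imsetP; exists i => //; apply: (subsetP SJ).
Qed.

(** * Decomposition over all coordinates and the duality estimate for small square functions *)

Section Bourgain.
Local Open Scope ring_scope.
Variables (R : realFieldType) (I Omega : finType) (pi : Omega -> R).
Hypothesis pi_ge0 : forall a, 0 <= pi a.
Hypothesis pi_sum : \sum_a pi a = 1.

Local Notation pt := {ffun I -> Omega}.
Implicit Types (f g h : pt -> R) (x y : pt) (i j : I) (S T : {set I}).
Local Notation mean := (wsum (weight pi)).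
Local Notation lap := (laplacian pi).

Definition efron_stein S f := es_part pi (enum I) S f.

Let w0 (x : pt) : 0 <= weight pi x := weight_ge0 pi_ge0 x.
Let w1 : \sum_(x : pt) weight pi x = 1 := weight_sum _ pi_sum.

Lemma setw_enum (c : R) S : setw c (enum I) S = c ^+ #|S|.
Proof.
rewrite /setw (_ : S \subset _) ?mul1r //.
by apply/subsetP => i _; rewrite inE mem_enum.
Qed.

Lemma wsum_setw_enum (c : R) (F : {set I} -> R) :
  wsum (setw c (enum I)) F = \sum_(S : {set I}) c ^+ #|S| * F S.
Proof. by apply: eq_bigr => S _; rewrite setw_enum. Qed.

Lemma efron_stein_lap i S f :
  efron_stein S (lap i f) = if i \in S then efron_stein S f else (fun=> 0).
Proof.
rewrite /efron_stein -(es_part_opC pi true) /= (lap_es_part pi_sum) ?mem_enum //.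
Qed.

Lemma parseval f :
  \sum_(S : {set I}) mean (fun x => efron_stein S f x ^+ 2) = mean (fun x => f x ^+ 2).
Proof.
rewrite -(parseval_seq pi_sum f (enum_uniq I)) wsum_setw_enum.
by apply: eq_bigr => S _; rewrite expr1n mul1r.
Qed.

Lemma influenceE i f : mean (fun x => lap i f x ^+ 2)
  = \sum_(S : {set I} | i \in S) mean (fun x => efron_stein S f x ^+ 2).
Proof.
rewrite -parseval [RHS]big_mkcond; apply: eq_bigr => S _.
rewrite efron_stein_lap; case: ifP => // _; apply: big1 => x _.
by rewrite expr0n mulr0.
Qed.

Lemma sum_card_swap (F : {set I} -> R) :
  \sum_i \sum_(S : {set I} | i \in S) F S = \sum_(S : {set I}) #|S|%:R * F S.
Proof.
rewrite (exchange_big_dep predT) //=; apply: eq_bigr => S _.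
by rewrite sumr_const mulr_natl.
Qed.

(** Since [f x] is a sign and its average lies in [-1, 1], |L_i f| = f L_i f = f^2 - f E_i f, and
    E_i is an orthogonal projection. *)
Lemma abs_lap_mean i f : (forall x, f x = 1 \/ f x = -1) ->
  mean (fun x => `|lap i f x|) = mean (fun x => lap i f x ^+ 2).
Proof.
move=> f1; rewrite (mean_lap_sqr pi_sum).
have avg1 x : -1 <= avg pi i f x <= 1.
  apply/andP; split.
    rewrite -[leLHS](wsum_cst _ pi_sum); apply: wsum_le => // a.
    by case: (f1 (upd x i a)) => ->; lra.
  rewrite -[leRHS](wsum_cst _ pi_sum); apply: wsum_le => // a.
  by case: (f1 (upd x i a)) => ->; lra.
under eq_wsum => x.
  have -> : `|lap i f x| = f x ^+ 2 - avg pi i f x * f x.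
    have /andP[a1 a2] := avg1 x; rewrite /laplacian.
    by case: (f1 x) => ->; [rewrite ger0_norm|rewrite ler0_norm]; lra.
  over.
by rewrite wsumB (mean_avgl pi_sum).
Qed.

(* Hoelder for the exponents 4 and 4/3, with the L^{4/3} norm of h interpolated
   between L^1 and L^2. *)
Lemma hoelder_L4 (W h : pt -> R) (v : R) :
  mean (fun x => `|h x|) = v -> mean (fun x => h x ^+ 2) = v ->
  mean (fun x => W x * h x) ^+ 4 <= mean (fun x => W x ^+ 4) * v ^+ 3.
Proof.
move=> hv1 hv2.
have v0 : 0 <= v by rewrite -hv2; apply: wsum_ge0 => // x; apply: sqr_ge0.
set a := mean (fun x => W x ^+ 4); set z := mean _.
set b := mean (fun x => W x ^+ 2 * `|h x|).
have b0 : 0 <= b by apply: wsum_ge0 => // x; rewrite mulr_ge0 ?sqr_ge0.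
have hb : b ^+ 2 <= a * v.
  apply: le_trans (wsum_CauchySchwarz _ _ _) _ => //.
  under eq_wsum do rewrite -exprM.
  under [X in _ * X]eq_wsum do rewrite real_normK ?num_real //.
  by rewrite hv2.
(* Cauchy-Schwarz for the measure with density |h|, applied to W sgn(h) and 1. *)
have hz : z ^+ 2 <= b * v.
  have wh0 x : 0 <= weight pi x * `|h x| by apply: mulr_ge0.
  have := wsum_CauchySchwarz wh0 (fun x => W x * Num.sg (h x)) (fun=> 1).
  rewrite /wsum; congr (_ ^+ 2 <= _ * _).
  - by apply: eq_bigr => x _; rewrite mulr1 [in RHS](numEsg (h x)); ring.
  - apply: eq_bigr => x _; rewrite exprMn sqr_sg.
    by case: eqVneq => [->|_]; rewrite ?normr0 /=; ring.
  - by rewrite -hv1; apply: eq_bigr => x _; rewrite expr1n mulr1.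
have -> : z ^+ 4 = (z ^+ 2) ^+ 2 by rewrite -exprM.
apply: (@le_trans _ _ ((b * v) ^+ 2)).
  by rewrite ler_pXn2r ?nnegrE ?sqr_ge0 // mulr_ge0.
rewrite exprMn [v ^+ 3]exprS mulrA; apply: ler_pM => //; apply: sqr_ge0.
Qed.

(** The weight 9^-|S| is the square of 3^-|S|: one factor is consumed by the dual inequality, the
    other goes into its family [G]. *)
Definition square_fun h x : R := \sum_(S : {set I}) 9^-1 ^+ #|S| * efron_stein S h x ^+ 2.

(** Self-adjointness of the parts rewrites the left side Z as E[W h], with [W] built from the
    truncated family [G]. The dual inequality gives E W^4 <= sigma^3 Z, so Hoelder yields Z^4 <=
    sigma^3 Z v^3; for Z > 0, divide by Z and take cube roots. *)
Lemma small_square_function h (sigma : R) : 0 <= sigma ->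
  mean (fun x => `|h x|) = mean (fun x => h x ^+ 2) ->
  mean (fun x => (square_fun h x < sigma ^+ 3)%R%:R * square_fun h x)
    <= sigma * mean (fun x => h x ^+ 2).
Proof.
move=> s0 hh; set V := square_fun h; set v := mean (fun x => h x ^+ 2); set Z := mean _.
have v0 : 0 <= v by apply: wsum_ge0 => // x; apply: sqr_ge0.
have V0 x : 0 <= V x.
  by apply: sumr_ge0 => S _; rewrite mulr_ge0 ?sqr_ge0 ?exprn_ge0 ?invr_ge0.
have Z0 : 0 <= Z by apply: wsum_ge0 => // x; rewrite mulr_ge0 ?ler0n.
pose b x : R := (V x < sigma ^+ 3)%R%:R.
pose G S x := b x * (3^-1 ^+ #|S| * efron_stein S h x).
pose W x : R := \sum_(S : {set I}) 3^-1 ^+ #|S| * efron_stein S (G S) x.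
have e9 m : (9^-1 : R) ^+ m = 3^-1 ^+ m * 3^-1 ^+ m.
  by rewrite -exprMn; congr (_ ^+ _); field.
have b2 x : b x * b x = b x by rewrite -natrM mulnb andbb.
have ZE : Z = mean (fun x => W x * h x).
  transitivity (\sum_(S : {set I}) 3^-1 ^+ #|S| * mean (fun x => G S x * efron_stein S h x)).
    under eq_bigr do rewrite -wsumZ; rewrite -wsum_sum; apply: eq_wsum => x.
    by rewrite mulr_sumr; apply: eq_bigr => S _; rewrite e9 /G -/(b x); ring.
  under eq_bigr do rewrite -(es_part_adj pi_sum) -wsumZ.
  rewrite -wsum_sum; apply: eq_wsum => x; rewrite mulr_suml.
  by apply: eq_bigr => S _; rewrite mulrA.
have W4 : mean (fun x => W x ^+ 4) <= sigma ^+ 3 * Z.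
  have := dual_square_function pi_ge0 pi_sum G (enum_uniq I).
  under eq_wsum do rewrite wsum_setw_enum.
  move=> /le_trans; apply; rewrite -wsumZ; apply: wsum_le => // x.
  rewrite wsum_setw_enum.
  have -> : \sum_(S : {set I}) 1 ^+ #|S| * G S x ^+ 2 = b x * V x.
    rewrite mulr_sumr; apply: eq_bigr => S _; rewrite expr1n e9 /G -[in RHS]b2; ring.
  rewrite exprMn -/(b x) [b x ^+ 2]b2 expr2 mulrCA.
  rewrite /b; case: ltP => [/ltW Vs|_]; rewrite ?mul0r ?mulr0 ?mul0r ?mul1r //.
  by rewrite ler_wpM2r.
have := hoelder_L4 W hh erefl; rewrite -ZE -/v => hZ.
have [->|Zn] := eqVneq Z 0; first exact: mulr_ge0.
have Zp : 0 < Z by rewrite lt_def Zn.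
rewrite -(@ler_pXn2r _ 3) ?nnegrE ?mulr_ge0 // -(ler_pM2l Zp) -exprS.
apply: le_trans hZ _; have -> : Z * (sigma * v) ^+ 3 = sigma ^+ 3 * Z * v ^+ 3 by ring.
by apply: ler_wpM2r W4; apply: exprn_ge0.
Qed.

(** * Sign-valued functions of mean zero and small total influence *)

Section Balanced.
(** [M] abstracts the maximum of the conditional means and [k] the floor of 10 C. *)
Variables (f M : pt -> R) (k : nat).
Hypothesis f_pm1 : forall x, f x = 1 \/ f x = -1.
Hypothesis f_mean : mean f = 0.
Hypothesis M_ge0 : forall x, 0 <= M x.
Hypothesis M_le1 : forall x, M x <= 1.
Hypothesis M_bound : forall T x, (0 < #|T| <= k)%N -> `|cond_mean pi T f x| <= M x.

Local Notation fS S := (efron_stein S f).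
Local Notation totinf := (\sum_i mean (fun x => lap i f x ^+ 2)).

Lemma sqr_f x : f x ^+ 2 = 1.
Proof. by case: (f_pm1 x) => ->; ring. Qed.

(** Seen as a conditional mean on all coordinates, [f] contributes only conditional means on subsets
    of [S], and the empty one vanishes. After squaring, M^2 <= M keeps the bound linear in [M], so
    that its mean can be taken. *)
Lemma efron_stein_le S x : (#|S| <= k)%N -> fS S x ^+ 2 <= 4 ^+ k * M x.
Proof.
move=> Sk; have : `|fS S x| <= 2 ^+ #|S| * M x.
  rewrite /efron_stein -[f in es_part _ _ _ f](cond_mean_setT pi_sum).
  have -> : #|S| = #|S :&: [set i in enum I]|.
    by apply: eq_card => i; rewrite !inE mem_enum andbT.
  apply: (es_part_cond_mean_le pi_sum (enum_uniq I)) => T _ TS _.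
  have {TS}TS : T \subset S.
    by apply: subset_trans TS; apply/subsetP => i iT; rewrite !inE iT mem_enum.
  have [->|T0] := eqVneq T set0; first by rewrite cond_mean_set0 f_mean normr0.
  by apply: M_bound; rewrite card_gt0 T0 (leq_trans (subset_leq_card TS)).
move=> h; rewrite -real_normK ?num_real //.
have -> : (4 : R) = 2 ^+ 2 by ring.
rewrite -exprM mulnC exprM.
apply: (@le_trans _ _ ((2 ^+ k * M x) ^+ 2)).
  rewrite ler_pXn2r ?nnegrE ?mulr_ge0 ?exprn_ge0 //.
  by apply: le_trans h _; apply: ler_wpM2r => //; apply: ler_weXn2l => //; lra.
rewrite exprMn; apply: ler_wpM2l; first exact: sqr_ge0.
have := M_ge0 x; have := M_le1 x; nra.
Qed.

Lemma efron_stein0 x : fS set0 x = 0.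
Proof.
apply/eqP; rewrite -normr_le0 /efron_stein -[f in es_part _ _ _ f](cond_mean_setT pi_sum).
have h := @es_part_cond_mean_le _ _ _ _ pi_sum (enum I) set0 setT f x 0 (enum_uniq I).
rewrite mulr0 in h; apply: h => T _ TS _.
have -> : T = set0.
  apply/eqP; rewrite -subset0; apply: subset_trans TS.
  by apply/subsetP => i iT; rewrite !inE iT mem_enum.
by rewrite cond_mean_set0 f_mean normr0.
Qed.

Lemma total_influenceE :
  totinf = \sum_(S : {set I}) #|S|%:R * mean (fun x => fS S x ^+ 2).
Proof. by rewrite -sum_card_swap; apply: eq_bigr => i _; apply: influenceE. Qed.

Hypothesis totinf_le : 10 * totinf <= k.+1%:R.

(** Markov's inequality: the mass above level k is at most the total influence over k + 1, hence at
    most 1/10 of the total mass 1; the empty set carries none. *)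
Lemma low_degree_mass :
  9 / 10 <= mean (fun x => \sum_(S : {set I} | (0 < #|S| <= k)%N) fS S x ^+ 2).
Proof.
rewrite wsum_sum; pose m S := mean (fun x => fS S x ^+ 2).
have m0 S : 0 <= m S by apply: wsum_ge0 => // x; apply: sqr_ge0.
have tot : \sum_(S : {set I}) m S = 1.
  by rewrite parseval -[RHS](wsum_cst 1 w1); apply: eq_wsum => x; apply: sqr_f.
have k0 : 0 < k.+1%:R :> R by rewrite ltr0n.
have : \sum_(S : {set I}) m S
    <= \sum_(S : {set I} | (0 < #|S| <= k)%N) m S + k.+1%:R^-1 * totinf.
  rewrite total_influenceE mulr_sumr [X in _ <= X + _]big_mkcond -big_split.
  apply: ler_sum => S _ /=; rewrite mulrA -/(m S).
  case: posnP => [S0|_ /=].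
    rewrite S0 mulr0 mul0r add0r; move/eqP: S0; rewrite cards_eq0 => /eqP ->.
    by rewrite /m; under eq_wsum do rewrite efron_stein0 expr0n; rewrite wsum_cst.
  case: leqP => [_|kS]; first by rewrite lerDl !mulr_ge0 ?invr_ge0.
  by rewrite add0r ler_peMl // mulrC ler_pdivlMr // mul1r ler_nat.
have : k.+1%:R^-1 * totinf <= 10^-1.
  rewrite mulrC ler_pdivrMr //; move: totinf_le; move: (k.+1%:R : R) (\sum_i _) => K t; lra.
rewrite tot; move: (_ * totinf) (\sum_(S | _) m S) => u v; lra.
Qed.

(** Chosen so that 9^k sigma [totinf] equals [totinf] / (k + 1), which is at most 1/10. *)
Definition notable_threshold : R := (9 ^+ k * k.+1%:R)^-1.
(** This is 10 * 4^k / sigma^3: with more notable coordinates than this, [V'] is at least 10 *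
    4^k. *)
Definition notable_bound : nat := 10 * 4 ^ k * (9 ^ k * k.+1) ^ 3.

Local Notation sigma := notable_threshold.
Local Notation L := notable_bound.
Local Notation V i x := (square_fun (lap i f) x).
Local Notation V' x := (\sum_(S : {set I}) 4^-1 ^+ #|S| * fS S x ^+ 2).

Lemma square_fun_lap i x : V i x = \sum_(S : {set I} | i \in S) 9^-1 ^+ #|S| * fS S x ^+ 2.
Proof.
rewrite [RHS]big_mkcond; apply: eq_bigr => S _; rewrite efron_stein_lap.
by case: ifP => // _; rewrite expr0n mulr0.
Qed.

Lemma square_fun_ge0 h x : 0 <= square_fun h x.
Proof. by apply: sumr_ge0 => S _; rewrite mulr_ge0 ?sqr_ge0 ?exprn_ge0 ?invr_ge0. Qed.

(** Exchanging the sums counts each set |S| times, and m 9^-m <= 4^-m. *)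
Lemma sum_square_fun x : \sum_i V i x <= V' x.
Proof.
under eq_bigr do rewrite square_fun_lap.
rewrite sum_card_swap; apply: ler_sum => S _; rewrite mulrA ler_wpM2r ?sqr_ge0 //.
elim: #|S| => [|m IH]; first by rewrite mul0r.
have : 0 <= (9^-1 : R) ^+ m <= 4^-1 ^+ m.
  by rewrite exprn_ge0 ?invr_ge0 //= lerXn2r ?nnegrE ?invr_ge0 //; lra.
rewrite !exprS -(natr1 m); move: (m%:R : R) (9^-1 ^+ m) (4^-1 ^+ m) IH => a p q IH.
by move=> /andP[p0 pq]; nra.
Qed.

Lemma sigma_gt0 : 0 < sigma.
Proof. by rewrite invr_gt0 mulr_gt0 ?exprn_gt0 ?ltr0n. Qed.

(** The three terms pay for the sets meeting a non-notable coordinate, for points with more than [L]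
    notable coordinates, and for the few sets left at the other points. *)
Lemma pointwise_bound x :
  \sum_(S : {set I} | (0 < #|S| <= k)%N) fS S x ^+ 2
  <= 9 ^+ k * \sum_i (V i x < sigma ^+ 3)%R%:R * V i x
     + 10^-1 * V' x ^+ 2 + (4 * L.+1%:R) ^+ k * M x.
Proof.
pose J := [set i | sigma ^+ 3 <= V i x].
have s3 : 0 < sigma ^+ 3 by rewrite exprn_gt0 ?sigma_gt0.
have V'0 : 0 <= V' x.
  by apply: sumr_ge0 => S _; rewrite mulr_ge0 ?sqr_ge0 ?exprn_ge0 ?invr_ge0.
have cJ : #|J|%:R * sigma ^+ 3 <= V' x.
  apply: le_trans (sum_square_fun x); rewrite [leRHS](bigID (mem J)) /=.
  apply: ler_wpDr; first by apply: sumr_ge0 => i _; apply: square_fun_ge0.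
  by rewrite mulr_natl -sumr_const; apply: ler_sum => i; rewrite inE.
rewrite (bigID (fun S => S \subset J)) /= addrC -addrA; apply: lerD.
  (* Each set not inside [J] is charged to its elements outside [J], of which there is at least one;
     the factor 9^k outweighs 9^-|S|. *)
  rewrite mulr_sumr.
  apply: (@le_trans _ _ (\sum_(S : {set I}) \sum_(i in S :\: J)
      9 ^+ k * (9^-1 ^+ #|S| * fS S x ^+ 2))).
    rewrite big_mkcond; apply: ler_sum => S _.
    have F0 : 0 <= 9 ^+ k * (9^-1 ^+ #|S| * fS S x ^+ 2).
      by rewrite mulr_ge0 ?exprn_ge0 // mulr_ge0 ?sqr_ge0 ?exprn_ge0 ?invr_ge0.
    case: ifP => [/andP[/andP[_ Sk] SJ]|_]; last by apply: sumr_ge0.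
    have /card_gt0P[i iS] : (0 < #|S :\: J|)%N by rewrite card_gt0 setD_eq0.
    rewrite (bigD1 i) //=; apply: ler_wpDr; first exact: sumr_ge0.
    rewrite mulrA ler_peMl ?sqr_ge0 // exprVn ler_pdivlMr ?exprn_gt0 // mul1r.
    by apply: ler_weXn2l => //; lra.
  rewrite (exchange_big_dep (fun i => i \notin J)) /=; last first.
    by move=> S i _; rewrite inE => /andP[].
  rewrite big_mkcond; apply: ler_sum => i _; rewrite inE -ltNge.
  case: ltP => _; last by rewrite mul0r mulr0.
  rewrite mul1r square_fun_lap mulr_sumr big_mkcond [leRHS]big_mkcond.
  apply: ler_sum => S _; rewrite inE.
  case: (i \in S); last by rewrite andbF.
  case: ifP => // _.
  by rewrite mulr_ge0 ?exprn_ge0 // mulr_ge0 ?sqr_ge0 ?exprn_ge0 ?invr_ge0.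
(* With at most [L] notable coordinates there are at most (L + 1)^k sets to count, each bounded by
   4^k M. *)
have [JL|JL] := leqP #|J| L.
  apply: ler_wpDl; first by rewrite mulr_ge0 ?sqr_ge0 ?invr_ge0.
  apply: (@le_trans _ _ (\sum_(S in
      [set S : {set I} | (S \subset J) && (#|S| <= k)%N]) 4 ^+ k * M x)).
    rewrite big_mkcond [leRHS]big_mkcond; apply: ler_sum => S _; rewrite inE.
    case: (S \subset J); last by rewrite andbF.
    rewrite andbT /=; case: (leqP #|S| k) => [Sk|]; last by rewrite andbF.
    by case: ifP => _; [apply: efron_stein_le|rewrite mulr_ge0 ?exprn_ge0].
  rewrite sumr_const -[leLHS]mulr_natl exprMn mulrA [4 ^+ k * _]mulrC.
  rewrite !ler_wpM2r ?exprn_ge0 // -natrX ler_nat.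
  apply: leq_trans (card_small_subsets J k) _.
  by case: (posnP k) => [->|k0]; rewrite ?expn0 ?leq_exp2r.
apply: ler_wpDr; first by rewrite mulr_ge0 ?exprn_ge0 ?mulr_ge0.
apply: (@le_trans _ _ (4 ^+ k * V' x)).
  rewrite mulr_sumr big_mkcond; apply: ler_sum => S _; case: ifP => [/andP[/andP[_ Sk] _]|_].
    rewrite mulrA ler_peMl ?sqr_ge0 // exprVn ler_pdivlMr ?exprn_gt0 // mul1r.
    by apply: ler_weXn2l => //; lra.
  by rewrite mulr_ge0 ?exprn_ge0 // mulr_ge0 ?sqr_ge0 ?exprn_ge0 ?invr_ge0.
(* This lower bound lets [V' x ^+ 2] / 10 absorb 4^k [V' x]. *)
have LV : 10 * 4 ^+ k <= V' x.
  apply: le_trans cJ; apply: (@le_trans _ _ (L%:R * sigma ^+ 3)).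
    rewrite /L natrM [(_ ^ 3)%:R]natrX !natrM !natrX /sigma exprVn -mulrA divff ?mulr1 //.
    by rewrite expf_neq0 // mulf_neq0 ?expf_neq0 ?pnatr_eq0.
  by rewrite ler_wpM2r ?(ltW s3) // ler_nat ltnW.
rewrite expr2 mulrA ler_wpM2r //; lra.
Qed.

(** Of the 9/10 of low-degree mass, the sets meeting non-notable coordinates and the exceptional
    points take at most 1/10 each. *)
Lemma mean_max_lower_bound : 7 / 10 <= (4 * L.+1%:R) ^+ k * mean M.
Proof.
have h := le_trans low_degree_mass (wsum_le w0 pointwise_bound).
rewrite !wsumD !wsumZ wsum_sum in h.
have h1 : \sum_i mean (fun x => (V i x < sigma ^+ 3)%R%:R * V i x) <= sigma * totinf.
  rewrite mulr_sumr; apply: ler_sum => i _; apply: small_square_function.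
    exact/ltW/sigma_gt0.
  exact: abs_lap_mean.
have h2 : mean (fun x => V' x ^+ 2) <= 1.
  have := square_function pi_ge0 pi_sum f (enum_uniq I).
  under eq_wsum do rewrite wsum_setw_enum.
  move=> /le_trans; apply; rewrite -[leRHS](wsum_cst 1 w1); apply: wsum_le => // x.
  by rewrite (exprM _ 2 2) sqr_f expr1n.
have h3 : 9 ^+ k * (sigma * totinf) <= 10^-1.
  rewrite mulrA /sigma invfM mulrA divff ?mul1r ?expf_neq0 ?pnatr_eq0 //.
  rewrite mulrC ler_pdivrMr ?ltr0n //; move: totinf_le.
  by move: (k.+1%:R : R) totinf => u v; lra.
have h4 := ler_wpM2l (exprn_ge0 k (ler0n R 9)) h1.
lra.
Qed.

End Balanced.
End Bourgain.

(** In powers of 2: 10 <= 2^4, 4^k = 2^(2k), (9^k (k+1))^3 <= 2^(15k), and 2^3 covers the outer 4 (L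
    + 1); then 7 + 17 k <= 24 k because k >= 1. *)
Lemma four_notable_bound_le k : (0 < k)%N ->
  ((4 * (notable_bound k).+1) ^ k <= 2 ^ (24 * k ^ 2))%N.
Proof.
move=> k0.
have k2 : (k.+1 <= 2 ^ k)%N by apply: ltn_expl.
have h4 : (4 ^ k = 2 ^ (2 * k))%N by rewrite expnM.
have h9 : (9 ^ k <= 2 ^ (4 * k))%N by rewrite expnM leq_exp2r.
have h10 : (10 <= 2 ^ 4)%N by [].
have h : ((9 ^ k * k.+1) ^ 3 <= 2 ^ (5 * k * 3))%N.
  have e5 : (5 * k = 4 * k + k)%N by lia.
  by rewrite expnM leq_exp2r // e5 expnD leq_mul.
have hL : (notable_bound k <= 2 ^ (4 + 2 * k + 5 * k * 3))%N.
  by rewrite /notable_bound h4 !(expnD 2) !leq_mul.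
have h24 : (4 * (notable_bound k).+1 <= 2 ^ (24 * k))%N.
  apply: (@leq_trans (2 ^ (3 + (4 + 2 * k + 5 * k * 3)))%N).
    rewrite [X in (_ <= X)%N]expnD; have : (0 < 2 ^ (4 + 2 * k + 5 * k * 3))%N by rewrite expn_gt0.
    by move: (2 ^ (4 + 2 * k + 5 * k * 3))%N hL => p; rewrite (_ : 2 ^ 3 = 8)%N //; lia.
  by rewrite leq_exp2l //; lia.
by rewrite (_ : k ^ 2 = k * k)%N // mulnA expnM leq_exp2r.
Qed.

(** * Transfer to the real numbers and the maximum of the statement *)

Lemma le_big_Rmax (T : eqType) (r : seq T) (P : pred T) (F : T -> R) i :
  i \in r -> P i -> Rle (F i) (\big[Rmax/R0]_(j <- r | P j) F j).
Proof.
elim: r => // j r IH; rewrite inE big_cons => /orP[/eqP <- ->|ir Pi].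
  exact: Rmax_l.
case: ifP => _; last exact: IH.
by apply: Rle_trans (IH ir Pi) _; apply: Rmax_r.
Qed.

Lemma expectE (Omega : finType) (pi : Omega -> R) n (F : pt Omega n -> R) :
  expect pi F = wsum (weight pi) F.
Proof. by []. Qed.

Lemma restrictE_cond_mean (Omega : finType) (pi : Omega -> R) n S (f : pt Omega n -> R) :
  restrictE pi S f = cond_mean pi S f.
Proof. by []. Qed.

Lemma total_infE (Omega : finType) (pi : Omega -> R) n (f : pt Omega n -> R) :
  total_inf pi f = (\sum_i wsum (weight pi) (fun x => laplacian pi i f x ^+ 2))%R.
Proof.
apply: eq_bigr => i _; rewrite /Inf expectE; apply: eq_wsum => x.
by rewrite RpowE.
Qed.

Local Open Scope R_scope.

Lemma nat_floor (x : R) : 0 <= x -> exists k : nat, INR k <= x < INR k + 1.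
Proof.
move=> /RleP x0; exists (Num.truncn x).
have /andP[/RleP h1 /RltP h2] := truncn_itv x0.
by rewrite -S_INR !INRE; split.
Qed.

Lemma max_restrict_ge0 (Omega : finType) (pi : Omega -> R) n B (f : pt Omega n -> R) x :
  0 <= max_restrict pi B f x.
Proof.
rewrite /max_restrict; apply: (big_ind (fun u => 0 <= u)) => [|u v u0 v0|S _].
- exact: Rle_refl.
- by apply: Rle_trans u0 _; apply: Rmax_l.
- exact: Rabs_pos.
Qed.

Lemma le_max_restrict (Omega : finType) (pi : Omega -> R) n B (f : pt Omega n -> R) x
    (S : {set 'I_n}) : (0 < #|S|)%N -> INR #|S| <= B ->
  Rabs (restrictE pi S f x) <= max_restrict pi B f x.
Proof.
move=> S0 SB; apply: (@le_big_Rmax _ _ _ (fun S => Rabs (restrictE pi S f x))).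
  by rewrite mem_index_enum.
by rewrite S0 /Defs.Rleb; case: Rle_dec.
Qed.

Lemma max_restrict_le1 (Omega : finType) (pi : Omega -> R) n B (f : pt Omega n -> R) x :
  is_prob pi -> (forall y, f y = 1 \/ f y = -1) -> max_restrict pi B f x <= 1.
Proof.
move=> [pi0 pi1] f1.
rewrite /max_restrict; apply: (big_ind (fun u => u <= 1)) => [|u v u0 v0|S _].
- exact: Rle_0_1.
- exact: Rmax_lub.
have w0 y : (0 <= weight pi y :> R)%R by apply: weight_ge0 => a; apply/RleP/pi0.
have w1 := weight_sum 'I_n pi1.
have h11 : -1 <= 1 by Lra.lra.
rewrite restrictE_cond_mean RabsE; apply/RleP; rewrite ler_norml; apply/andP; split.
  rewrite -[leLHS](wsum_cst _ w1); apply: wsum_le => // y.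
  by case: (f1 [ffun i => if i \in S then x i else y i]) => ->; apply/RleP;
    [exact: h11|exact: Rle_refl].
rewrite -[leRHS](wsum_cst _ w1); apply: wsum_le => // y.
by case: (f1 [ffun i => if i \in S then x i else y i]) => ->; apply/RleP;
  [exact: Rle_refl|exact: h11].
Qed.

Theorem theorem1 :
  exists K : R, 0 < K /\
  forall (Omega : finType) (pi : Omega -> R) (n : nat) (C : R)
         (f : {ffun 'I_n -> Omega} -> R),
    is_prob pi ->
    0 < C ->
    (forall x, f x = 1 \/ f x = -1) ->
    expect pi f = 0 ->
    total_inf pi f < C ->
    expect pi (max_restrict pi (10 * C) f) > Rpower 2 (- (K * C ^ 2)).
Proof.
(* Since 1 <= k <= 10 C, 24 k^2 + 1 <= 25 k^2 <= 2500 C^2. *)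
exists 2500; split; first by Lra.lra.
move=> Omega pi n C f pi_prob C0 f1 f0 fC.
have [pi0 pi1] := pi_prob.
set M := max_restrict pi (10 * C) f.
have [k [kC Ck]] : exists k : nat, INR k <= 10 * C < INR k + 1 by apply: nat_floor; Lra.lra.
have pi0' a : (0 <= pi a :> R)%R by apply/RleP/pi0.
have M0 x : (0 <= M x :> R)%R by apply/RleP/max_restrict_ge0.
have M1 x : (M x <= 1 :> R)%R by apply/RleP/max_restrict_le1.
have Mb (T : {set 'I_n}) x : (0 < #|T| <= k)%N -> (`|cond_mean pi T f x| <= M x :> R)%R.
  move=> /andP[T0 Tk]; rewrite -RabsE; apply/RleP/le_max_restrict => //.
  by apply: Rle_trans kC; apply: le_INR; apply/ssrnat.leP.
have Ik : (10 * (\sum_i wsum (weight pi) (fun x => laplacian pi i f x ^+ 2)) <= k.+1%:R :> R)%R.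
  rewrite -total_infE -INRE S_INR.
  have -> : (10%:R : R)%R = 10 by rewrite -INRE INR_IZR_INZ.
  by apply/RleP; rewrite -RmultE; Lra.lra.
have core := mean_max_lower_bound pi0' pi1 f1 f0 M0 M1 Mb Ik.
rewrite expectE; set m := wsum (weight pi) M in core *.
have {}core : 7 / 10 <= INR ((4 * (notable_bound k).+1) ^ k) * m.
  move: core => /RleP; rewrite INRE natrX natrM RmultE; apply: Rle_trans.
  by right; rewrite RdivE; congr (_ / _)%R; rewrite -INRE INR_IZR_INZ.
have m0 : 0 <= m by apply/RleP/wsum_ge0 => // x; apply: weight_ge0.
(* For k = 0 no nonempty set has size at most 10 C < 1, so the maximum is everywhere its default 0,
   against [core]. *)
have k0 : (0 < k)%N.
  rewrite lt0n; apply/eqP => k0.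
  have : m = 0.
    rewrite /m /wsum big1 // => x _.
    suff -> : M x = 0 by rewrite mulr0.
    rewrite /M /max_restrict big_pred0 // => S; apply/negbTE/negP => /andP[S0].
    rewrite /Defs.Rleb; case: Rle_dec => // SB _.
    apply: (Rlt_irrefl 1); apply: Rle_lt_trans (le_INR 1 #|S| (elimT ssrnat.leP S0)) _.
    by apply: Rle_lt_trans SB _; rewrite k0 Rplus_0_l in Ck.
  by move=> mE; rewrite mE in core; Lra.lra.
have {}core : 7 / 10 <= 2 ^ (24 * k ^ 2) * m.
  apply: Rle_trans core _; apply: Rmult_le_compat_r => //.
  rewrite -[2]/(INR 2) -pow_INR; apply: le_INR; apply/ssrnat.leP.
  have -> : Nat.pow 2 (24 * k ^ 2) = (2 ^ (24 * k ^ 2))%N.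
    by elim: (_ * _)%N => //= e ->; rewrite expnS; lia.
  exact: four_notable_bound_le.
have p0 : 0 < 2 ^ (24 * k ^ 2) by apply: pow_lt; Lra.lra.
apply: Rlt_gt; apply: (Rmult_lt_reg_l _ _ _ p0).
apply: Rlt_le_trans core.
rewrite -Rpower_pow; last by Lra.lra.
rewrite -Rpower_plus.
have k1 : 1 <= INR k by apply: (le_INR 1); apply/ssrnat.leP.
have -> : INR (24 * k ^ 2) = 24 * INR k ^ 2.
  rewrite !INRE natrM natrX RmultE RpowE; congr (_ * _)%R.
  by rewrite -INRE INR_IZR_INZ.
(* The exponent 24 k^2 - 2500 C^2 is at most -1, and 1/2 < 7/10 gives the strict inequality. *)
apply: (@Rle_lt_trans _ (Rpower 2 (- (1)))).
  by apply: Rle_Rpower; [Lra.lra | Psatz.nra].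
by rewrite Rpower_Ropp Rpower_1; Lra.lra.
Qed.
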